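(* Let $Q>0$ and let $T$ be a rooted tree with root $o$, having at least one edge, in which every vertex $x\ne o$ belongs to at least two edges. Then $(\partial T,\bar\rho)$ is Ahlfors $Q$-regular if and only if there are constants $0<a_0<a_1$ such that, for all vertices $x\in T$ and all $S\in\operatorname{Stop}(x)$, $$a_0\,2^{-Q|x|}\le\sum_{y\in S}2^{-Q|y|}\le a_1\,2^{-Q|x|}.$$
   Context: A tree $T$ is a connected graph without cycles; $T$ also denotes its vertex set. $|x|$ is the number of edges of the geodesic $[o,x]$ from the root $o$ to the vertex $x$. $T(x)$ is the set of vertices $y$ with $x\in[o,y]$. The boundary $\partial T$ is the set of infinite geodesic rays starting at $o$ (infinite paths from $o$ with no repeated edges). For a vertex $x$, $\partial T(x)\subseteq\partial T$ is the set of rays passing through $x$. For $\zeta\neq\xi$ in $\partial T$, $\zeta\wedge\xi$ is the last vertex (the one furthest from $o$) common to the two rays, and the metric is $\bar\rho(\zeta,\xi)=2^{-|\zeta\wedge\xi|}$, with $\bar\rho(\zeta,\zeta)=0$. $\operatorname{Stop}(x)$ is the family of stopping regions below $x$: the sets of vertices $S\subseteq T(x)$ such that the sets $\partial T(y)$, $y\in S$, are pairwise disjoint and $\bigcup_{y\in S}\partial T(y)=\partial T(x)$. For $s>0$, a metric space $(Z,d)$ is Ahlfors $s$-regular if it has at least two points and there are constants $0<c<C$ such that $c\,r^s\le \mathcal{H}^s(B(z,r))\le C\,r^s$ for every $z\in Z$ and $0<r\le \operatorname{diam}(Z)$, $r$ real, where $\mathcal{H}^s$ is the $s$-dimensional Hausdorff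 measure, $\mathcal{H}^s(A)=\lim_{\eta\to0}\inf\{\sum_n \operatorname{diam}(U_n)^s:\ A\subseteq\bigcup_n U_n,\ \operatorname{diam}(U_n)\le\eta\}$. *)

(* Defs.v *)
From HB Require Import structures.
From mathcomp Require Import all_boot all_order all_algebra.
From mathcomp Require Import finmap.
From mathcomp Require Import all_classical all_reals all_analysis.

Set Implicit Arguments.
Unset Strict Implicit.
Unset Printing Implicit Defensive.

Import Order.TTheory GRing.Theory Num.Theory.
Import numFieldNormedType.Exports.

Local Open Scope classical_set_scope.
Local Open Scope ring_scope.

(** * Rooted trees *)

Definition is_tree (V : choiceType) (e : rel V) : Prop :=
  [/\ symmetric e, irreflexive e,
      forall x y : V, exists2 p : seq V, path e x p & last x p = y
    & forall c : seq V, ucycle e c -> (size c <= 2)%N].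

(* The vertex set is arbitrary: the tree need not be locally finite. *)
Structure rooted_tree := RootedTree {
  vertex :> choiceType;
  adj : rel vertex;
  troot : vertex;
  adj_tree : is_tree adj }.

Arguments adj {_} x y.
Arguments troot {_}.

Section Tree.
Variable T : rooted_tree.
Implicit Types (x y z : T) (p q : seq T).

(* The edges traversed by the path x :: p, as unordered pairs. *)
Definition edges x p : seq {fset T} :=
  pairmap (fun a b => [fset a; b]%fset) x p.

(* The geodesic [x, y] is encoded as x :: p. *)
Definition is_geodesic x y p : Prop :=
  [/\ path adj x p, last x p = y & uniq (edges x p)].

(* By [geodesicP] and [geodesic_unique] below, this is the only p with
   [is_geodesic x y p]. *)
Definition geodesic x y : seq T := xget [::] [set p | is_geodesic x y p].

Definition level x : nat := size (geodesic troot x).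

Definition subtree x : set T := [set y | x \in troot :: geodesic troot y].

Definition is_ray (zeta : nat -> T) : Prop :=
  [/\ zeta 0%N = troot, forall n, adj (zeta n) (zeta n.+1)
    & injective (fun n => [fset zeta n; zeta n.+1]%fset)].

Definition boundary : Type := {zeta : nat -> T | is_ray zeta}.

Definition on_ray (zeta : boundary) : set T := range (sval zeta).

Definition boundary_below x : set boundary := [set zeta | on_ray zeta x].

Definition ray_meet (zeta xi : boundary) : T :=
  xget troot [set x | (on_ray zeta `&` on_ray xi) x /\
    forall y, (on_ray zeta `&` on_ray xi) y -> (level y <= level x)%N].

Definition Stop x : set (set T) :=
  [set S | [/\ S `<=` subtree x, trivIset S boundary_below
             & \bigcup_(y in S) boundary_below y = boundary_below x]].

(** ** Uniqueness of geodesics *)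

Lemma adj_sym : symmetric (@adj T). Proof. by case: (adj_tree T). Qed.
Lemma adj_irr : irreflexive (@adj T). Proof. by case: (adj_tree T). Qed.

Lemma mem_edges x p a b :
  [fset a; b]%fset \in edges x p -> (a \in x :: p) && (b \in x :: p).
Proof.
elim: p x => [|y p IH] x //=; rewrite inE => /orP[/eqP E|/IH].
  have : a \in [fset x; y]%fset by rewrite -E !inE eqxx.
  have : b \in [fset x; y]%fset by rewrite -E !inE eqxx orbT.
  by rewrite !inE => /orP[]-> /orP[]->; rewrite ?orbT.
by rewrite !inE => /andP[-> ->]; rewrite !orbT.
Qed.

Lemma uniq_edges x p : uniq (x :: p) -> uniq (edges x p).
Proof.
elim: p x => [|y p IH] x //= /andP[xp yp]; rewrite IH// andbT.
by apply: contra xp => /mem_edges/andP[].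
Qed.

Lemma edges_uniq x p : path adj x p -> uniq (edges x p) -> uniq (x :: p).
Proof.
elim: p x => [|y p IH] x //; rewrite [path _ _ _]/= => /andP[xy yp].
rewrite [edges _ _]/= [uniq (_ :: edges _ _)]/= => /andP[xyN /(IH _ yp) uyp] {IH}.
rewrite cons_uniq uyp andbT; apply/negP => xyp.
have [p1 [p2 E]] : exists p1 p2, y :: p = p1 ++ x :: p2.
  by case/splitPr: xyp => p1 p2; exists p1, p2.
case: p1 E => [[yx _]|z p1 [yz E]]; first by rewrite yx adj_irr in xy.
subst z p; move: uyp yp xyN {xyp}; rewrite /= mem_cat cat_uniq cat_path /= inE.
case/and4P=> yN up1 /norP[xNp1 _] _ /and3P[yp1 lx _] xyN.
move: yN; rewrite !negb_or => /and3P[yNp1 yNx _].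
have [_ _ _ /(_ (x :: y :: p1))] := adj_tree T.
rewrite /ucycle /= rcons_path xy yp1 lx /= in_cons negb_or eq_sym yNx.
rewrite yNp1 up1 xNp1 /= => /(_ isT).
by case: p1 {yNp1 xNp1 up1 yp1 lx} xyN => //=; rewrite inE fsetUC eqxx.
Qed.

Lemma upath_unique x p q : path adj x p -> path adj x q ->
  uniq (x :: p) -> uniq (x :: q) -> last x p = last x q -> p = q.
Proof.
elim: p x q => [|a p IH] x [|b q] //.
- by move=> _ _ _ /= /andP[+ _] E; rewrite E mem_last.
- by move=> _ _ /= /andP[+ _] _ E; rewrite -E mem_last.
move=> pp pq up uq E; have [ab|ab] := eqVneq a b.
  subst b; congr (_ :: _); move: pp pq up uq => /= /andP[_ pp] /andP[_ pq].
  by move=> /andP[_ up] /andP[_ uq]; apply: (IH a).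
exfalso.
have hasP : has (mem (b :: q)) (a :: p).
  by apply/hasP; exists (last x (a :: p)); [|rewrite /= in E *; rewrite E];
    rewrite /= mem_last.
have [p1 [z [p2 [Ep zq Np1]]]] : exists p1 z p2,
    [/\ a :: p = p1 ++ z :: p2, z \in b :: q & ~~ has (mem (b :: q)) p1].
  by case: (split_find hasP) => z p1 p2 *; exists p1, z, p2; rewrite cat_rcons.
have [q1 [q2 Eq]] : exists q1 q2, b :: q = q1 ++ z :: q2.
  by case/splitPr: zq => q1 q2; exists q1, q2.
have [_ _ _ /(_ (x :: p1 ++ z :: rev q1))] := adj_tree T.
move: pp pq up uq Np1; rewrite Ep Eq !cat_path /= !cat_uniq !mem_cat /= !inE.
case/and3P=> pp1 lz _ /and3P[pq1 lz' _] /and4P[xp up1 Np1 uz].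
case/and4P=> xq uq1 Nq1 uz' /hasPn N1.
move: xp xq Np1 Nq1; rewrite !negb_or => /and3P[xp1 xz _] /and3P[xq1 _ _].
move=> /andP[zp1 _] /andP[zq1 _].
have rp : path adj z (rcons (rev q1) x).
  rewrite -rev_cons -(belast_rcons x q1 z) -{1}(last_rcons x q1 z) rev_path.
  by rewrite (eq_path (e' := adj)) ?rcons_path ?pq1// => ? ?; rewrite adj_sym.
rewrite /ucycle /= rcons_cat cat_path /= pp1 lz rp /=.
rewrite mem_cat cat_uniq /= inE !mem_rev !negb_or rev_uniq.
rewrite xp1 xz xq1 up1 zp1 zq1 uq1 /= andbT.
have -> : ~~ has (in_mem^~ (mem p1)) (rev q1).
  apply/hasPn => u; rewrite mem_rev => uq; apply/negP => /N1 /=.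
  by rewrite mem_cat uq.
move=> /(_ isT); rewrite size_cat /= size_rev addnS !ltnS leqn0 addn_eq0.
rewrite !size_eq0 => /andP[/eqP p10 /eqP q10].
by move: Ep Eq ab; rewrite p10 q10 => -[-> _] [-> _]; rewrite eqxx.
Qed.

Lemma geodesicP x y : is_geodesic x y (geodesic x y).
Proof.
have [_ _ /(_ x y)[p xp xy] _] := adj_tree T.
apply: (@xgetPex _ [::] [set p | is_geodesic x y p]); move: xy.
by case/shortenP: xp => q xq uq _ xy; exists q; split=> //; exact: uniq_edges.
Qed.

Lemma geodesic_unique x y p : is_geodesic x y p -> geodesic x y = p.
Proof.
have [gp gl ge] := geodesicP x y => -[pp pl pe].
by apply: (@upath_unique x) => //; [exact: edges_uniq..|rewrite gl pl].
Qed.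

(** ** Rays *)

Lemma ray_geodesic (zeta : boundary) n :
  geodesic troot (sval zeta n) = mkseq (fun i => sval zeta i.+1) n.
Proof.
case: zeta => zeta [z0 zS zi] /=; apply: geodesic_unique.
have E : mkseq (fun i => zeta i.+1) n.+1 =
    rcons (mkseq (fun i => zeta i.+1) n) (zeta n.+1) by rewrite mkseqS.
have pathn m : path adj troot (mkseq (fun i => zeta i.+1) m) /\
    last troot (mkseq (fun i => zeta i.+1) m) = zeta m.
  elim: m => [|m [IH1 IH2]]; first by rewrite z0.
  by rewrite mkseqS rcons_path last_rcons IH1 IH2 zS.
have [pn ln] := pathn n; split=> //.
have -> : edges troot (mkseq (fun i => zeta i.+1) n) =
    mkseq (fun i => [fset zeta i; zeta i.+1]%fset) n.
  elim: n {E pn ln} => // n IH; rewrite !mkseqS /edges -!cats1 pairmap_cat.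
  by rewrite -[pairmap _ _ (mkseq _ _)]/(edges _ _) IH (pathn n).2.
exact: mkseq_uniq.
Qed.

Lemma level_ray (zeta : boundary) n : level (sval zeta n) = n.
Proof. by rewrite /level ray_geodesic size_mkseq. Qed.

Lemma ray0 (zeta : boundary) : sval zeta 0%N = troot.
Proof. by case: zeta => ? []. Qed.

Lemma ray_agree (zeta xi : boundary) n m i : sval zeta n = sval xi m ->
  (i <= n)%N -> sval zeta i = sval xi i.
Proof.
move=> E; have nm : n = m by rewrite -(level_ray zeta n) E level_ray.
subst m; case: i => [_|i lin]; first by rewrite !ray0.
have := congr1 (geodesic troot) E; rewrite !ray_geodesic.
by move/(congr1 (nth troot ^~ i)); rewrite !nth_mkseq.
Qed.

Lemma boundary_eq (zeta xi : boundary) :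
  (forall n, sval zeta n = sval xi n) -> zeta = xi.
Proof. by case: zeta xi => f ? [g ?] /= /funext E; apply: eq_exist. Qed.

Lemma ray_meetC (zeta xi : boundary) : ray_meet zeta xi = ray_meet xi zeta.
Proof. by rewrite /ray_meet setIC. Qed.

Lemma ray_meetP (zeta xi : boundary) i : zeta <> xi ->
  (i <= level (ray_meet zeta xi))%N <-> sval zeta i = sval xi i.
Proof.
move=> zx.
have exk : exists k, sval zeta k != sval xi k.
  apply: contrapT => /forallNP H; apply: zx; apply: boundary_eq => n.
  by apply/eqP/negP => /negP /H.
case: (ex_minnP exk) => -[|N] neqN minN.
  by rewrite !ray0 eqxx in neqN.
have eqN : sval zeta N = sval xi N.
  by apply/eqP/negP => /negP /minN; rewrite ltnn.
have leN n m : sval zeta n = sval xi m -> (n <= N)%N.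
  move=> E; rewrite leqNgt; apply/negP => Nn.
  by case/eqP: neqN; exact: ray_agree E Nn.
have : [set x | (on_ray zeta `&` on_ray xi) x /\ forall y,
    (on_ray zeta `&` on_ray xi) y -> (level y <= level x)%N] (ray_meet zeta xi).
  apply: xgetPex; exists (sval zeta N); split.
    by split; [exists N|exists N].
  by move=> y [[n _ <-] [m _ /esym/leN]]; rewrite !level_ray.
move=> [[[n _ nw] [m _ mw]] /(_ (sval zeta N))].
have -> : level (ray_meet zeta xi) = n by rewrite -nw level_ray.
rewrite level_ray => /(_ (conj (ex_intro2 _ _ N I erefl)
  (ex_intro2 _ _ N I (esym eqN)))) Nn.
split=> [|/leN iN]; last exact: leq_trans Nn.
by apply: (@ray_agree _ _ n m); rewrite nw mw.
Qed.

End Tree.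

(** * The metric on the boundary *)

HB.instance Definition _ (T : rooted_tree) := gen_eqMixin (boundary T).
HB.instance Definition _ (T : rooted_tree) := gen_choiceMixin (boundary T).

(* A copy of [boundary T] recording the field in which distances are taken. *)
Definition boundary_metric (R : realType) (T : rooted_tree) : Type :=
  boundary T.

Section BoundaryMetric.
Variables (R : realType) (T : rooted_tree).
Implicit Types zeta xi chi : boundary_metric R T.

HB.instance Definition _ := Choice.on (boundary_metric R T).

Definition rho zeta xi : R :=
  if zeta == xi then 0 else 2 ^- level (ray_meet zeta xi).

Lemma rhoxx zeta : rho zeta zeta = 0. Proof. by rewrite /rho eqxx. Qed.

Lemma rho_positivity zeta xi : rho zeta xi = 0 -> zeta = xi.
Proof.
rewrite /rho; case: eqP => // _ /eqP.
by rewrite invr_eq0 expf_eq0 pnatr_eq0 andbF.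
Qed.

Lemma rho_sym zeta xi : rho zeta xi = rho xi zeta.
Proof. by rewrite /rho eq_sym ray_meetC. Qed.

Lemma rho_ge0 zeta xi : 0 <= rho zeta xi.
Proof. by rewrite /rho; case: ifP => // _; rewrite invr_ge0 exprn_ge0. Qed.

Lemma rho_triangle chi zeta xi : rho zeta xi <= rho zeta chi + rho chi xi.
Proof.
have [<-|zc] := eqVneq zeta chi; first by rewrite rhoxx add0r.
have [<-|cx] := eqVneq chi xi; first by rewrite rhoxx addr0.
have [<-|zx] := eqVneq zeta xi; first by rewrite rhoxx addr_ge0 ?rho_ge0.
wlog le : zeta xi zc cx zx /
    (level (ray_meet zeta chi) <= level (ray_meet chi xi))%N.
  move=> H; case/orP: (leq_total (level (ray_meet zeta chi))
    (level (ray_meet chi xi))) => le; first exact: H.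
  rewrite addrC (rho_sym zeta) (rho_sym zeta) (rho_sym chi).
  by apply: H; [rewrite eq_sym..|rewrite (ray_meetC xi) (ray_meetC chi zeta)].
apply: (@le_trans _ _ (rho zeta chi)); last by rewrite lerDl rho_ge0.
rewrite /rho (negbTE zx) (negbTE zc) lef_pV2 ?posrE ?exprn_gt0//.
rewrite ler_weXn2l ?ler1n//; apply/(ray_meetP _ (elimN eqP zx)).
by rewrite ((ray_meetP _ (elimN eqP zc)).1 (leqnn _)) ((ray_meetP _ (elimN eqP cx)).1 le).
Qed.

HB.instance Definition _ := @isMetric.Build R (boundary_metric R T)
  rho rhoxx rho_positivity rho_sym rho_triangle.

End BoundaryMetric.

(** * Hausdorff measure and Ahlfors regularity *)

Section Ahlfors.
Variables (R : realType) (Z : metricType R).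
Implicit Types (A : set Z) (s : R).

(* The maximum with 0 only matters for the empty set, where the supremum
   is -oo. *)
Definition diam A : \bar R :=
  maxe 0%E (ereal_sup [set (mdist x y)%:E | x in A & y in A]).

Definition hausdorff_premeasure s (eta : R) A : \bar R :=
  ereal_inf [set (\sum_(0 <= n <oo) poweR (diam (U n)) s)%E |
    U in [set U : (set Z)^nat | A `<=` \bigcup_n U n /\
                                forall n, (diam (U n) <= eta%:E)%E]].

Definition hausdorff_measure s A : \bar R :=
  lim (hausdorff_premeasure s eta A @[eta --> 0^'+]).

(* The library's [closed_ball z r] is the closure of the open ball, which in
   an ultrametric space such as [boundary_metric R T] is the open ball. *)
Definition cball (z : Z) (r : R) : set Z := [set w | mdist z w <= r].

(* The balls are the closed ones. With open balls the condition would not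
   bound the measure of Z itself: it would hold with s = 1 for the boundary of
   the tree whose root has infinitely many children, each being the root of a
   binary tree. *)
Definition ahlfors_regular s : Prop :=
  (exists z w : Z, z <> w) /\
  exists c C : R, [/\ 0 < c, c < C &
    forall (z : Z) (r : R), 0 < r -> (r%:E <= diam [set: Z])%E ->
      ((c * r `^ s)%:E <= hausdorff_measure s (cball z r) <=
       (C * r `^ s)%:E)%E].

End Ahlfors.

Arguments ahlfors_regular {R} Z s.

(* Main.v *)
(* The cylinders bT(x), the sets of rays through a vertex x, are the balls of
   the boundary bT, and Stop(x) consists of the partitions of bT(x) into
   cylinders.

   If the stopping sums are controlled, the partitions of bT(x) into cylinders
   of one small level bound H^Q(bT(x)) from above. Conversely every set of a
   cover of bT(x) can be enlarged to a cylinder at the cost of a factor 2^Q,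
   and the minimal vertices of these cylinders form a stopping region; no
   compactness is needed. So H^Q(bT(x)) is comparable to 2^(-Q|x|).

   If bT is regular then H^Q(bT(y)) is comparable to 2^(-Q|y|) for every vertex
   y, and superadditivity of H^Q on finite families of disjoint cylinders
   (which lie at positive distance) and its countable subadditivity yield the
   two bounds on the stopping sums. Since only constants matter, both are
   obtained with a loss of a factor 2 that avoids every passage to the limit. *)
Require Import Defs.
From mathcomp Require Import all_boot all_order all_algebra.
From mathcomp Require Import finmap.
From mathcomp Require Import all_classical all_reals all_analysis.

Set Implicit Arguments.
Unset Strict Implicit.
Unset Printing Implicit Defensive.

Import Order.TTheory GRing.Theory Num.Theory.
Import numFieldNormedType.Exports.

Local Open Scope classical_set_scope.
Local Open Scope ring_scope.

(** * Rays and stopping regions *)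

Lemma geodesic_upath {T : rooted_tree} (x : T) :
  [/\ path adj troot (geodesic troot x), last troot (geodesic troot x) = x
    & uniq (troot :: geodesic troot x)].
Proof. by have [p l u] := geodesicP troot x; split=> //; exact: edges_uniq. Qed.

Lemma geodesic_upathE {T : rooted_tree} (x : T) p : path adj troot p ->
  uniq (troot :: p) -> last troot p = x -> geodesic troot x = p.
Proof.
by move=> pp up lp; apply: geodesic_unique; split=> //; exact: uniq_edges.
Qed.

(** If [y] is off the geodesic to [x], appending [y] keeps it simple. Otherwise its stretch from [y]
    to [x] and the single edge are two simple paths, equal by [upath_unique]. *)
Lemma geodesic_adj {T : rooted_tree} (x y : T) : adj x y ->
  geodesic troot y = rcons (geodesic troot x) y \/
  geodesic troot x = rcons (geodesic troot y) x.
Proof.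
move=> xy; have [px lx ux] := geodesic_upath x.
have [yx|yx] := boolP (y \in troot :: geodesic troot x); last first.
  left; apply: geodesic_upathE; rewrite ?last_rcons ?rcons_path ?lx ?px//.
  by rewrite -rcons_cons rcons_uniq yx.
right; case/splitPl: yx px lx ux => p1 p2 l1.
rewrite cat_path last_cat l1 => /andP[p1p p2p] l2.
rewrite -cat_cons cat_uniq => /and3P[u1 /hasPn u12 u2].
have -> : p2 = [:: x].
  apply: (@upath_unique T y) => //=.
  - by rewrite adj_sym xy.
  - rewrite u2 andbT; apply/negP => /u12.
    by rewrite /= -l1 mem_last.
  - by rewrite inE andbT; apply: contraTneq xy => ->; rewrite adj_irr.
by rewrite cats1 (@geodesic_upathE _ y p1).
Qed.

Lemma level_root {T : rooted_tree} : level (@troot T) = 0%N.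
Proof. by rewrite /level (@geodesic_upathE _ _ [::]). Qed.

Lemma level_eq0 {T : rooted_tree} (x : T) : level x = 0%N -> x = troot.
Proof. by move=> /size0nil E; have [_ <- _] := geodesic_upath x; rewrite E. Qed.

Lemma geodesic_nth {T : rooted_tree} (x : T) i : (i <= level x)%N ->
  geodesic troot (nth troot (troot :: geodesic troot x) i) =
  take i (geodesic troot x).
Proof.
move=> ix; have [px lx ux] := geodesic_upath x; apply: geodesic_upathE.
- exact: take_path.
- by rewrite -[_ :: _]/(take i.+1 (troot :: geodesic troot x)) take_uniq.
- rewrite (last_nth troot) size_takel// -[_ :: _]/(take i.+1 (_ :: _)).
  by rewrite nth_take.
Qed.

(** At most one neighbour of a vertex is its parent, so of two neighbours one is a child. At the
    root, the child is taken on the geodesic to a vertex of positive level. *)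
Lemma exists_child {T : rooted_tree} (has_edge : exists x y : T, adj x y)
    (two_edges : forall x : T, x <> troot ->
      exists y z : T, [/\ y <> z, adj x y & adj x z]) (x : T) :
  exists y, geodesic troot y = rcons (geodesic troot x) y.
Proof.
have [->|/eqP/two_edges[y [z [yz xy xz]]]] := eqVneq x troot.
  have [y y0] : exists y : T, level y != 0%N.
    move: has_edge => [a [b ab]].
    have [/level_eq0 a0|] := eqVneq (level a) 0%N; last by exists a.
    have [/level_eq0 b0|] := eqVneq (level b) 0%N; last by exists b.
    by move: ab; rewrite a0 b0 adj_irr.
  exists (nth troot (troot :: geodesic troot y) 1).
  rewrite geodesic_nth ?lt0n// (size0nil level_root).
  move: y0; rewrite /level; case: (geodesic troot y) => //= a l _.
  by rewrite take0.
have [Ey|Ey] := geodesic_adj xy; first by exists y.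
have [Ez|Ez] := geodesic_adj xz; first by exists z.
move: (Ey); rewrite Ez => /rcons_inj[E]; case: yz.
have [_ <- _] := geodesic_upath y; have [_ <- _] := geodesic_upath z.
by rewrite E.
Qed.

(** Iterating a choice of child prolongs the geodesic to [x] forever; the ray is read off these
    nested geodesics. *)
Lemma exists_ray {T : rooted_tree} (has_edge : exists x y : T, adj x y)
    (two_edges : forall x : T, x <> troot ->
      exists y z : T, [/\ y <> z, adj x y & adj x z]) (x : T) :
  boundary_below x !=set0.
Proof.
have [f fE] := choice (exists_child has_edge two_edges).
pose v i := iter i f x; pose g i := troot :: geodesic troot (v i).
have gS i : g i.+1 = rcons (g i) (v i.+1) by rewrite /g /v iterS fE.
have lv i : level (v i) = (i + level x)%N.
  elim: i => // i IH; rewrite /level /v iterS fE size_rcons.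
  by rewrite -[size _]/(level (v i)) IH.
have sg i : size (g i) = (i + level x).+1 by rewrite -lv.
have nth_g i j k : (k <= i + level x)%N -> (i <= j)%N ->
    nth troot (g j) k = nth troot (g i) k.
  move=> ki /subnK <-; elim: (j - i)%N => // d IH.
  rewrite addSn gS nth_rcons sg (leq_ltn_trans ki) ?IH//.
  by rewrite ltnS leq_add2r leq_addl.
(* The list [g n] has [n + level x + 1] entries, so entry [n] exists; by [zE] it is the same in
   every [g m] that is long enough. *)
pose zeta n := nth troot (g n) n.
have zE n m : (n <= m + level x)%N -> zeta n = nth troot (g m) n.
  move=> nm; rewrite /zeta; have [mn|/ltnW mn] := leqP m n; first exact: nth_g.
  by rewrite [RHS](@nth_g n)// leq_addr.
have lz n : level (zeta n) = n.
  by rewrite /level geodesic_nth ?size_takel -?[size _]/(level _) ?lv ?leq_addr.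
have zinj n m : zeta n = zeta m -> n = m.
  by move/(congr1 (@level T)); rewrite !lz.
have zray : is_ray zeta.
  split=> [//|n|n m E].
    have [p _ _] := geodesic_upath (v n.+1).
    rewrite (zE n n.+1) ?(zE n.+1 n.+1) ?leq_addr//; last first.
      by rewrite addSn (leq_trans (leqnSn n))// ltnS leq_addr.
    move/(pathP troot): p => /(_ n); apply.
    by rewrite -[size _]/(level _) lv addSn ltnS leq_addr.
  have : zeta n \in [fset zeta m; zeta m.+1]%fset by rewrite -E !inE eqxx.
  rewrite !inE => /orP[/eqP/zinj//|/eqP/zinj nm].
  have : zeta n.+1 \in [fset zeta m; zeta m.+1]%fset.
    by rewrite -E !inE eqxx orbT.
  rewrite !inE => /orP[/eqP/zinj|/eqP/zinj]; last by case.
  by move=> mn; move: nm; rewrite -mn => /eqP; rewrite ltn_eqF// ltnS leqnSn.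
exists (exist _ zeta zray); exists (level x) => //=.
rewrite (zE _ 0%N)// /g /v /=; have [_ + _] := geodesic_upath x.
by rewrite (last_nth troot).
Qed.

Lemma boundary_belowP {T : rooted_tree} (x : T) z :
  boundary_below x z <-> sval z (level x) = x.
Proof.
split; last by exists (level x).
by move=> [n _ <-]; rewrite level_ray.
Qed.

Lemma subtree_ray {T : rooted_tree} (z : boundary T) n m : (m <= n)%N ->
  subtree (sval z m) (sval z n).
Proof.
case: m => [|m] mn; first by rewrite /subtree /= ray0 mem_head.
rewrite /subtree /= ray_geodesic inE; apply/orP; right; apply/mapP.
by exists m; rewrite ?mem_iota.
Qed.

Lemma subtree_boundary {T : rooted_tree} (x y : T) : subtree x y ->
  boundary_below y `<=` boundary_below x.
Proof.
move=> + z [n _ zn]; rewrite /subtree /= -zn ray_geodesic inE => /predU1P[->|].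
  by exists 0%N; rewrite ?ray0.
by move=> /mapP[i _ ->]; exists i.+1.
Qed.

(** Every ray has exactly one vertex at level [n]. These regions provide covers of arbitrarily small
    mesh. *)
Lemma stop_level {T : rooted_tree} (x : T) n : (level x <= n)%N ->
  Stop x [set y | subtree x y /\ level y = n].
Proof.
move=> xn; split=> [y []//|y y' [_ yn] [_ y'n] [z [zy zy']]|].
  move/boundary_belowP: zy => <-; move/boundary_belowP: zy' => <-.
  by rewrite yn y'n.
apply/seteqP; split=> [z [y [xy _]]|z xz]; first exact: subtree_boundary.
exists (sval z n); last by exists n.
by split; [move/boundary_belowP: xz => <-; exact: subtree_ray|exact: level_ray].
Qed.

(** Keep the first vertex of [Y] on each ray through [x]. Rays through a vertex share all earlier
    vertices, so being first does not depend on the ray. *)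
Lemma stop_of_cover {T : rooted_tree} (x : T) (Y : set T) :
  Y `<=` subtree x ->
  boundary_below x `<=` \bigcup_(y in Y) boundary_below y ->
  exists2 S, Stop x S & S `<=` Y.
Proof.
move=> Yx xY; pose S := [set y | Y y /\ forall z, boundary_below y z ->
  forall i, (i < level y)%N -> ~ Y (sval z i)].
exists S; last by move=> y [].
split=> [y [/Yx]//|y y' [Yy minY] [Yy' minY'] [z [zy zy']]|].
  move/boundary_belowP: (zy) => zE; move/boundary_belowP: (zy') => zE'.
  have [lt|lt|E] := ltngtP (level y) (level y').
  - by case: (minY' z zy' _ lt); rewrite zE.
  - by case: (minY z zy _ lt); rewrite zE'.
  - by rewrite -zE -zE' E.
apply/seteqP; split=> [z [y [/Yx xy _]]|z xz]; first exact: subtree_boundary.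
have exn : exists n, `[< Y (sval z n) >].
  have [y Yy [n _ zn]] := xY z xz.
  by exists n; apply/asboolP; rewrite zn.
case: (ex_minnP exn) => n /asboolP Yn nmin.
exists (sval z n); last by exists n.
split=> // w [m _ wm] i; rewrite level_ray => ni Yi.
have E := ray_agree (esym wm); move: Yi.
by rewrite -E ?(ltnW ni)// => /asboolP/nmin; rewrite leqNgt ni.
Qed.

(** * Unordered sums *)

Lemma esum_subset {R : realType} {I : choiceType} (A B : set I)
    (a : I -> \bar R) : A `<=` B ->
  (\esum_(i in A) a i <= \esum_(i in B) a i)%E.
Proof.
move=> AB; apply: ge_ereal_sup => _ [X [finX XA] <-]; apply: esum_ge.
by exists X => //; split=> //; exact: subset_trans AB.
Qed.

(** A chosen section of [f] is injective on [S], which turns the left-hand sum into one over a part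
    of [D]. *)
Lemma esum_le_reindex {R : realType} {I : choiceType} {J : pointedType}
    (S : set I) (D : set J) (f : J -> I) (a : I -> \bar R) :
  S `<=` f @` D -> (\esum_(i in S) a i <= \esum_(j in D) a (f j))%E.
Proof.
move=> SfD.
have /choice[g gP] i : exists j, S i -> D j /\ f j = i.
  by have [/SfD[j Dj fj]|nSi] := pselect (S i); [exists j|exists point].
have -> : (\esum_(i in S) a i = \esum_(j in g @` S) a (f j))%E.
  rewrite esum_image; first by apply: eq_esum => i /gP[_ ->].
  move=> i i' /set_mem /gP[_ E] /set_mem /gP[_ E'] gg.
  by rewrite -E -E' gg.
by apply: esum_subset => _ [i /gP[Di _] <-].
Qed.

Lemma esumZl_le {R : realType} {I : choiceType} (S : set I) (c : R)
    (a : I -> \bar R) : 0 <= c -> (forall i, S i -> 0 <= a i)%E ->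
  (\esum_(i in S) (c%:E * a i) <= c%:E * \esum_(i in S) a i)%E.
Proof.
move=> c0 a0; apply: ge_ereal_sup => _ [X [finX XS] <-].
rewrite fsbig_finite//= big_seq.
rewrite -ge0_sume_distrr; last first.
  by move=> i; rewrite in_fset_set// => /set_mem/XS/a0.
rewrite -big_seq -fsbig_finite//; apply: lee_wpmul2l; first by rewrite lee_fin.
by apply: ereal_sup_ubound; exists X.
Qed.

(** For each [n] only finitely many terms are at least [1/(n+1)]. As the tree need not be locally
    finite, this is how stopping regions are shown to be countable, which covers by sequences
    require. *)
Lemma esum_lty_countable {R : realType} {I : choiceType} (D : set I)
    (a : I -> \bar R) : (forall i, D i -> 0 < a i)%E ->
  (\esum_(i in D) a i < +oo)%E -> countable D.
Proof.
move=> a0 aoo; pose E n := [set i | D i /\ (n.+1%:R^-1%:E <= a i)%E].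
apply: (@sub_countable _ _ _ (\bigcup_n E n)).
  apply: subset_card_le => i Di; have := a0 _ Di.
  case ai : (a i) => [r| |]// r0; last first.
    by exists 0%N => //; split; rewrite ?ai ?leey.
  have [n _ /(_ n (leqnn n)) nr] :=
    near_infty_natSinv_lt (PosNum (r0 : (0 < r)%R)).
  by exists n => //; split=> //; rewrite ai lee_fin ltW.
apply: bigcup_countable => // n _; apply: finite_set_countable.
apply: contrapT => Einf.
suff aE : \esum_(i in D) a i = +oo%E by move: aoo; rewrite aE ltxx.
apply/eqyP => r r0.
(* More than [r * (n+1)] terms, each at least [1/(n+1)], add up to at least [r]. *)
have [B BE Br] := infinite_set_fset (Num.truncn (r * n.+1%:R)).+1 Einf.
apply: esum_ge; exists [set` B]; first by split=> // i /BE[].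
rewrite fsbig_finite//= set_fsetK.
apply: (@le_trans _ _ (\sum_(i <- B) n.+1%:R^-1%:E)%E); last first.
  by rewrite big_seq [leRHS]big_seq; apply: lee_sum => i /BE[].
rewrite sumEFin lee_fin big_const_seq count_predT iter_addr_0 -[leRHS]mulr_natr.
rewrite -ler_pdivrMl ?invr_gt0// invrK mulrC ltW//.
by apply: lt_le_trans (truncnS_gt _) _; rewrite ler_nat.
Qed.

(** * Hausdorff measure *)

Section Hausdorff.
Variables (R : realType) (Z : metricType R).
Implicit Types (A B : set Z) (s eta : R).
Local Open Scope ereal_scope.

Lemma diam_ge0 A : 0 <= diam A.
Proof. by rewrite /diam le_max lexx. Qed.

Lemma mdist_le_diam A x y : A x -> A y -> (mdist x y)%:E <= diam A.
Proof.
move=> Ax Ay; rewrite /diam le_max; apply/orP; right.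
by apply: ereal_sup_ubound; exists x => //; exists y.
Qed.

Lemma diam_le A (d : R) : (0 <= d)%R ->
  (forall x y, A x -> A y -> (mdist x y <= d)%R) -> diam A <= d%:E.
Proof.
move=> d0 dA; rewrite /diam ge_max lee_fin d0 /=; apply: ge_ereal_sup.
by move=> _ [x Ax [y Ay <-]]; rewrite lee_fin dA.
Qed.

Lemma diam_set0 : diam (@set0 Z) = 0.
Proof. by apply/le_anti; rewrite diam_ge0 andbT; apply: diam_le. Qed.

Lemma le_diam A B : A `<=` B -> diam A <= diam B.
Proof.
move=> AB; rewrite {1}/diam ge_max diam_ge0 /=; apply: ge_ereal_sup.
by move=> _ [x Ax [y Ay <-]]; apply: mdist_le_diam; exact: AB.
Qed.

Lemma diam_fin_num A (d : R) : diam A <= d%:E -> diam A = (fine (diam A))%:E.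
Proof.
move=> Ad; rewrite fineK// fin_numElt (lt_le_trans (ltNyr 0) (diam_ge0 A)).
exact: le_lt_trans Ad (ltry d).
Qed.

Lemma le_poweR s (a b : \bar R) : (0 <= s)%R -> 0 <= a -> a <= b ->
  a `^ s <= b `^ s.
Proof.
move=> s0 a0 ab; apply: gt0_ler_poweR => //; rewrite in_itv/= ?leey ?a0//.
by rewrite (le_trans a0 ab).
Qed.

Lemma hausdorff_premeasure_nonincreasing s A :
  {homo (hausdorff_premeasure s ^~ A) : x y / (x <= y)%R >-> y <= x}.
Proof.
move=> x y xy; apply: le_ereal_inf => _ [U [AU Ux] <-]; exists U => //.
by split=> // n; rewrite (le_trans (Ux n)).
Qed.

(** The premeasure grows as [eta] decreases, so its limit at 0 from the right is a supremum. *)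
Lemma hausdorff_measureE s A : hausdorff_measure s A =
  ereal_sup [set hausdorff_premeasure s eta A | eta in `]0%R, +oo[ ].
Proof.
apply/cvg_lim => //; apply: (@nonincreasing_at_right_cvge _ _ _ +oo%O).
  by rewrite bnd_simp.
by move=> x y _ _; exact: hausdorff_premeasure_nonincreasing.
Qed.

Lemma hausdorff_premeasure_le s A eta : (0 < eta)%R ->
  hausdorff_premeasure s eta A <= hausdorff_measure s A.
Proof.
move=> eta0; rewrite hausdorff_measureE; apply: ereal_sup_ubound.
by exists eta; rewrite //= in_itv/= eta0.
Qed.

Lemma hausdorff_measure_le s A M :
  (forall eta, (0 < eta)%R -> hausdorff_premeasure s eta A <= M) ->
  hausdorff_measure s A <= M.
Proof.
move=> AM; rewrite hausdorff_measureE; apply: ge_ereal_sup => _ [eta + <-].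
by rewrite /= in_itv/= andbT => /AM.
Qed.

Lemma hausdorff_measure_gt s A M : M < hausdorff_measure s A ->
  exists2 eta, (0 < eta)%R & M < hausdorff_premeasure s eta A.
Proof.
rewrite hausdorff_measureE => /ereal_sup_gt[_ [eta + <-] ?].
by rewrite /= in_itv/= andbT; exists eta.
Qed.

Lemma le_hausdorff_measure s A B : A `<=` B ->
  hausdorff_measure s A <= hausdorff_measure s B.
Proof.
move=> AB; apply: hausdorff_measure_le => eta eta0.
apply: le_trans (hausdorff_premeasure_le s B eta0).
apply: le_ereal_inf => _ [U [BU Ueta] <-]; exists U => //.
by split=> //; exact: subset_trans BU.
Qed.

(** An injection of [D] into the integers turns the family into a sequence. The remaining integers
    receive the empty set, which costs nothing because [s] is nonzero. *)
Lemma hausdorff_premeasure_le_esum (I : choiceType) (D : set I)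
    (U : I -> set Z) s eta A : s != 0%R -> (0 <= eta)%R -> countable D ->
  A `<=` \bigcup_(i in D) U i -> (forall i, D i -> diam (U i) <= eta%:E) ->
  hausdorff_premeasure s eta A <= \esum_(i in D) diam (U i) `^ s.
Proof.
move=> s0 eta0 /countable_injP[f finj] AU Ueta.
pose V n := \bigcup_(i in D `&` [set i | f i = n]) U i.
have VE i : D i -> V (f i) = U i.
  move=> Di; apply/seteqP; split=> [z [j [Dj fji]]|z Uz]; last by exists i.
  by rewrite (finj j i)// inE.
have V0 n : ~ (f @` D) n -> V n = set0.
  by move=> fDn; apply/seteqP; split=> // z [i [Di fi] _]; apply: fDn; exists i.
have -> : \esum_(i in D) diam (U i) `^ s = \sum_(0 <= n <oo) diam (V n) `^ s.
  rewrite nneseries_esumT//; last by move=> n; exact: poweR_ge0.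
  rewrite (esumID (f @` D)); last by move=> *; exact: poweR_ge0.
  rewrite [X in _ = _ + X]esum1 ?adde0 ?setTI; last first.
    by move=> n /V0 ->; rewrite diam_set0 poweR0r.
  by rewrite esum_image//; apply: eq_esum => i /VE ->.
apply: ereal_inf_lbound; exists V => //; split=> [z /AU[i Di Uz]|n].
  by exists (f i); rewrite ?VE.
have [[i Di <-]|/V0 ->] := pselect ((f @` D) n); first by rewrite VE ?Ueta.
by rewrite diam_set0 lee_fin.
Qed.

End Hausdorff.

(** A set of diameter at most [eta] meets at most one [A i]. Hence the traces of a cover of [B] on
    the sets [A i] use each term of the cover at most once. *)
Lemma sum_hausdorff_premeasure_le {R : realType} {Z : metricType R}
    {I : eqType} (F : seq I) (A : I -> set Z) (B : set Z) (s eta : R) :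
  0 < s -> uniq F -> (forall i, i \in F -> A i `<=` B) ->
  (forall i j, i \in F -> j \in F -> i != j ->
    forall x y, A i x -> A j y -> eta < mdist x y) ->
  (\sum_(i <- F) hausdorff_premeasure s eta (A i)
     <= hausdorff_premeasure s eta B)%E.
Proof.
move=> s0 uF AB sep; apply: le_ereal_inf_tmp => _ [U [BU Ueta] <-].
pose V i n := U n `&` A i.
apply: (@le_trans _ _
    (\sum_(i <- F) \sum_(0 <= n <oo) poweR (diam (V i n)) s)%E).
  rewrite big_seq [leRHS]big_seq; apply: lee_sum => i iF.
  apply: ereal_inf_lbound; exists (V i) => //; split=> [z Aiz|n].
    by have [n _ Unz] := BU z (AB i iF z Aiz); exists n.
  by apply: le_trans (Ueta n); apply: le_diam => z [].
rewrite -nneseries_sum; last by move=> *; exact: poweR_ge0.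
apply: lee_nneseries => n *; first by apply: sume_ge0 => *; exact: poweR_ge0.
have V0 i : ~ (V i n !=set0) -> poweR (diam (V i n)) s = 0%E.
  by move=> /set0P/negP/negPn/eqP ->; rewrite diam_set0 poweR0r// gt_eqF.
have [[i [iF [x [Ux Aix]]]]|noV] := pselect (exists i, i \in F /\ V i n !=set0).
  rewrite (bigD1_seq i)//= big_seq_cond big1 ?adde0.
    apply: le_poweR; [exact: ltW|exact: diam_ge0|].
    by apply: le_diam => z [].
  move=> j /andP[jF ji]; apply: V0 => -[y [Uy Ajy]].
  have := sep i j iF jF; rewrite eq_sym => /(_ ji x y Aix Ajy).
  rewrite ltNge -lee_fin => /negP; apply; apply: le_trans (Ueta n).
  exact: mdist_le_diam.
rewrite big_seq big1 ?poweR_ge0// => i iF; apply: V0 => Vi.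
by apply: noV; exists i.
Qed.

(** * Cylinders *)

(** The minimum of finitely many thresholds works, since each condition holds at all smaller scales.
    In [esum_weight_le] it gives finitely many cylinders one common scale. *)
Lemma exists_common_bound {R : realType} {I : eqType} (F : seq I)
    (P : I -> R -> Prop) :
  (forall i, i \in F -> exists2 e, 0 < e & forall t, 0 < t <= e -> P i t) ->
  exists2 e, 0 < e & forall i, i \in F -> P i e.
Proof.
move=> FP; suff [e e0 eP] : exists2 e, 0 < e &
    forall i, i \in F -> forall t, 0 < t <= e -> P i t.
  by exists e => // i iF; apply: (eP i iF); rewrite e0 lexx.
elim: F FP => [|i F IH] FP; first by exists 1.
have [e e0 eP] : exists2 e, 0 < e & forall i, i \in F ->
    forall t, 0 < t <= e -> P i t.
  by apply: IH => j jF; apply: FP; rewrite inE jF orbT.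
have [e' e'0 e'P] := FP i (mem_head _ _).
exists (Num.min e e'); first by rewrite lt_min e0.
move=> j /[!inE] /predU1P[->|jF] t; rewrite le_min => /and3P[t0 te te'].
  by apply: e'P; rewrite t0.
by apply: (eP j jF); rewrite t0.
Qed.

Lemma exists_dyadic {R : realType} (t : R) : 0 < t <= 1 ->
  exists n, 2 ^- n.+1 < t <= 2 ^- n.
Proof.
move=> /andP[t0 t1].
have exn : exists n, (2 ^- n < t :> R).
  have [n _ /(_ n (leqnn n))/=] := near_infty_natSinv_expn_lt (PosNum t0).
  by rewrite div1r; exists n.
case: (ex_minnP exn) => -[|n] nt nmin.
  by rewrite expr0 invr1 ltNge t1 in nt.
by exists n; rewrite nt leNgt; apply/negP => /nmin; rewrite ltnn.
Qed.

Section Cylinders.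
Variables (R : realType) (Q : R) (T : rooted_tree).

Definition weight n : R := 2 `^ (- (Q * n%:R)).

Lemma weightE n : weight n = (2 ^- n) `^ Q.
Proof. by rewrite /weight mulrC -mulNr powRrM powR_invn. Qed.

Lemma weight_gt0 n : 0 < weight n.
Proof. exact: powR_gt0. Qed.

Lemma weightS n : weight n = 2 `^ Q * weight n.+1.
Proof.
rewrite /weight -powRD; last by rewrite pnatr_eq0 implybT.
by rewrite -[n.+1]addn1 natrD mulrDr mulr1 opprD addrCA subrr addr0.
Qed.

Lemma mdist_le_dyadic (z w : boundary_metric R T) n :
  (mdist z w <= 2 ^- n) <-> sval z n = sval w n.
Proof.
rewrite -[mdist z w]/(rho z w) /rho; case: eqP => [->|zw].
  by rewrite invr_ge0 exprn_ge0.
rewrite lef_pV2 ?posrE ?exprn_gt0// ler_eXn2l ?ltr1n//.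
exact: ray_meetP.
Qed.

(** Retyping in the metric copy of the boundary makes [diam] and [hausdorff_measure] applicable. *)
Definition cylinder (x : T) : set (boundary_metric R T) := boundary_below x.

Lemma cylinder_mdist x (z w : boundary_metric R T) : cylinder x z ->
  cylinder x w <-> mdist z w <= 2 ^- level x.
Proof.
move=> /boundary_belowP zx; rewrite mdist_le_dyadic.
by split=> [/boundary_belowP ->|zw]//; apply/boundary_belowP; rewrite -zw.
Qed.

Lemma cylinder_ray (z : boundary_metric R T) n :
  cylinder (sval z n) = [set w | mdist z w <= 2 ^- n].
Proof.
apply/seteqP; split=> w /=; rewrite (@cylinder_mdist _ z) ?level_ray//;
  by exists n.
Qed.

Lemma diam_cylinder x : (diam (cylinder x) <= (2 ^- level x)%:E)%E.
Proof.
apply: diam_le; first by rewrite invr_ge0 exprn_ge0.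
by move=> z w zx /(cylinder_mdist _ zx).
Qed.

Lemma diam_boundary_le1 : (diam [set: boundary_metric R T] <= 1)%E.
Proof.
apply: diam_le => // z w _ _.
by rewrite -[leRHS]invr1 -(expr0 2); apply/mdist_le_dyadic; rewrite !ray0.
Qed.

Lemma disjoint_cylinder (S : set T) x y z : trivIset S (@boundary_below T) ->
  S x -> S y -> cylinder x z -> cylinder y z -> x = y.
Proof. by move=> tS Sx Sy xz yz; apply: (tS _ _ Sx Sy); exists z. Qed.

End Cylinders.

(** * Stopping sums and Ahlfors regularity *)

Section Regularity.
Variables (R : realType) (Q : R) (T : rooted_tree).
Hypothesis Q_gt0 : 0 < Q.

Local Notation weight := (weight Q).
Local Notation cylinder := (@cylinder R T).
Local Notation H := (@hausdorff_measure R (boundary_metric R T) Q).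

(** The cylinders of one deep level [n] below [x] form a cover of mesh at most [eta], and each
    contributes at most its weight. The bound [M] on the sum of the weights also makes this cover
    countable. *)
Lemma hausdorff_cylinder_le x (M : R) :
  (forall S, Stop x S -> (\esum_(y in S) (weight (level y))%:E <= M%:E)%E) ->
  (H (cylinder x) <= M%:E)%E.
Proof.
move=> SM; apply: hausdorff_measure_le => eta eta0.
have [m _ /(_ m (leqnn m))/=] := near_infty_natSinv_expn_lt (PosNum eta0).
rewrite div1r => meta; set n := maxn m (level x).
have St := stop_level (leq_maxr m (level x)); rewrite -/n in St.
set S := [set y | _] in St.
have neta : 2 ^- n <= eta.
  apply: le_trans (ltW meta).
  by rewrite lef_pV2 ?posrE ?exprn_gt0// ler_eXn2l ?ltr1n// leq_maxl.
apply: le_trans (SM _ St).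
apply: (@le_trans _ _ (\esum_(y in S) poweR (diam (cylinder y)) Q)%E).
  apply: hausdorff_premeasure_le_esum; rewrite ?gt_eqF ?(ltW eta0)//.
  - apply: (@esum_lty_countable R _ _ (fun y => (weight (level y))%:E)).
      by move=> y _; rewrite lte_fin weight_gt0.
    by rewrite (le_lt_trans (SM _ St)) ?ltry.
  - by case: St => _ _ ->.
  - move=> y [_ yn]; apply: le_trans (diam_cylinder _ _) _.
    by rewrite yn lee_fin.
apply: le_esum => y _; rewrite weightE -poweR_EFin.
by apply: le_poweR; [exact: ltW|exact: diam_ge0|exact: diam_cylinder].
Qed.

(* A set of positive diameter at most [2 ^- level x] lies in a cylinder of
   comparable weight; for a set of diameter 0 the weight can only be made
   small, whence the error term. *)
Lemma exists_enclosing_cylinder x (A : set (boundary_metric R T)) (e : R) :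
  0 < e -> (diam A <= (2 ^- level x)%:E)%E -> A `&` cylinder x !=set0 ->
  exists y, [/\ subtree x y, A `<=` cylinder y
    & ((weight (level y))%:E <=
        (2 `^ Q)%:E * (poweR (diam A) Q + e%:E))%E].
Proof.
move=> e0 Ax [z [Az xz]]; have dE := diam_fin_num Ax.
have := diam_ge0 A; move: Ax; rewrite dE !lee_fin; set d := fine _ => dx d0.
have [t [t0 dt tx te]] : exists t, [/\ 0 < t, d <= t, t <= 2 ^- level x
    & t `^ Q <= d `^ Q + e].
  move: d0; rewrite le_eqVlt => /predU1P[<-|d0]; last first.
    by exists d; rewrite lexx lerDl (ltW e0).
  (* A set of diameter 0 is given a positive scale [t] whose power [t ^ Q] is at most [e]. *)
  exists (Num.min (2 ^- level x) (e `^ Q^-1)); split.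
  - by rewrite lt_min powR_gt0// invr_gt0 exprn_gt0.
  - by rewrite le_min powR_ge0 invr_ge0 exprn_ge0.
  - by rewrite ge_min lexx.
  - apply: (@le_trans _ _ ((e `^ Q^-1) `^ Q)).
      apply: ge0_ler_powR; rewrite ?nnegrE ?powR_ge0 ?(ltW Q_gt0)//.
        by rewrite le_min powR_ge0 invr_ge0 exprn_ge0.
      by rewrite ge_min lexx orbT.
    by rewrite -powRrM mulVf ?gt_eqF// powRr1 ?(ltW e0)// lerDr powR_ge0.
have t01 : 0 < t <= 1.
  by rewrite t0 (le_trans tx)// invf_le1 ?exprn_gt0// exprn_ege1// ler1n.
have [n /andP[nt tn]] := exists_dyadic t01.
(* From [2 ^- n.+1 < t <= 2 ^- level x] follows [level x < n.+1], so the vertex of level [n] on the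
   ray [z] lies below [x]. *)
have xn : (level x <= n)%N.
  have := lt_le_trans nt tx.
  by rewrite ltf_pV2 ?posrE ?exprn_gt0// ltr_eXn2l ?ltr1n// ltnS.
exists (sval z n); split.
- by move/boundary_belowP: xz => <-; exact: subtree_ray.
- move=> w Aw; rewrite cylinder_ray /= (le_trans _ tn)// (le_trans _ dt)//.
  by rewrite -lee_fin -dE; exact: mdist_le_diam.
- rewrite level_ray weightS poweR_EFin -EFinD -EFinM lee_fin.
  rewrite ler_pM2l ?powR_gt0//.
  apply: le_trans te; rewrite weightE; apply: ge0_ler_powR.
  + exact: ltW.
  + by rewrite nnegrE invr_ge0 exprn_ge0.
  + by rewrite nnegrE ltW.
  + exact: ltW.
Qed.

(** The vertices of the cylinders enclosing those [U n] that meet the cylinder of [x] contain a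
    stopping region, by [stop_of_cover]. Its sum is at least [m], and it is at most the sum of the
    enclosing weights. *)
Lemma weight_le_cover x (m : R) (U : (set (boundary_metric R T))^nat) :
  (forall S, Stop x S -> (m%:E <= \esum_(y in S) (weight (level y))%:E)%E) ->
  cylinder x `<=` \bigcup_n U n ->
  (forall n, (diam (U n) <= (2 ^- level x)%:E)%E) ->
  (m%:E <= (2 `^ Q)%:E * \sum_(0 <= n <oo) poweR (diam (U n)) Q)%E.
Proof.
move=> Sm xU Ux; apply/lee_addgt0Pr => e e0.
have M0 : 0 < 2 `^ Q :> R by rewrite powR_gt0.
(* The errors [e' / 2 ^ n.+1] add up to [e'], and the enlargement factor [2 ^ Q] turns this into
   [e]. *)
pose e' := e / 2 `^ Q; have e'0 : 0 < e' by rewrite divr_gt0.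
pose D := [set n | U n `&` cylinder x !=set0].
pose b n := (poweR (diam (U n)) Q + (e' / (2 ^ n.+1)%:R)%:E)%E.
have b0 n : (0 <= b n)%E.
  by rewrite adde_ge0 ?poweR_ge0// lee_fin divr_ge0// ltW.
have /choice[y yP] n : exists y, D n -> [/\ subtree x y, U n `<=` cylinder y
    & ((weight (level y))%:E <= (2 `^ Q)%:E * b n)%E].
  have [Dn|nDn] := pselect (D n); last by exists x.
  have en : 0 < e' / (2 ^ n.+1)%:R by rewrite divr_gt0// ltr0n expn_gt0.
  by have [y ?] := exists_enclosing_cylinder en (Ux n) Dn; exists y.
have [S St SY] : exists2 S, Stop x S & S `<=` y @` D.
  apply: stop_of_cover => [_ [n /yP[xy _ _] <-]//|z xz].
  have [n _ Uz] := xU z xz; have Dn : D n by exists z.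
  by exists (y n); [exists n|have [_ + _] := yP n Dn; apply].
apply: le_trans (Sm _ St) _; apply: le_trans (esum_le_reindex _ SY) _.
apply: (@le_trans _ _ (\sum_(0 <= n <oo) ((2 `^ Q)%:E * b n))%E).
  have Mb0 n : (0 <= (2 `^ Q)%:E * b n)%E by rewrite mule_ge0// lee_fin ltW.
  rewrite nneseries_esumT//; apply: le_trans (esum_subset _ (@subsetT _ D)).
  by apply: le_esum => n /yP[].
rewrite nneseriesZl//.
have -> : e%:E = ((2 `^ Q)%:E * e'%:E)%E.
  by rewrite -EFinM /e' mulrC divfK// gt_eqF.
rewrite -ge0_muleDr; last 2 first.
- by apply: nneseries_ge0 => *; exact: poweR_ge0.
- by rewrite lee_fin ltW.
apply: lee_wpmul2l; first by rewrite lee_fin ltW.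
by apply: epsilon_trick => *; rewrite ?poweR_ge0 ?ltW.
Qed.

Lemma hausdorff_cylinder_ge x (m : R) :
  (forall S, Stop x S -> (m%:E <= \esum_(y in S) (weight (level y))%:E)%E) ->
  ((m / 2 `^ Q)%:E <= H (cylinder x))%E.
Proof.
move=> Sm; have x0 : 0 < 2 ^- level x :> R by rewrite invr_gt0 exprn_gt0.
(* The single scale [2 ^- level x] suffices, as every premeasure is below the measure. *)
apply: le_trans (hausdorff_premeasure_le Q _ x0).
apply: le_ereal_inf_tmp => _ [U [xU Ux] <-].
rewrite mulrC EFinM lee_pdivrMl ?powR_gt0//.
exact: weight_le_cover Sm xU Ux.
Qed.

(** A ball of radius in [(2 ^- n.+1, 2 ^- n]] lies between the cylinders of levels [n.+1] and [n]
    around its centre, so the bounds for cylinders pass to balls. *)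
Lemma ahlfors_of_stop (a0 a1 : R) : 0 < a0 -> a0 < a1 ->
  (forall x : T, boundary_below x !=set0) ->
  (forall (x : T) (S : set T), Stop x S ->
    ((a0 * weight (level x))%:E <= \esum_(y in S) (weight (level y))%:E
      <= (a1 * weight (level x))%:E)%E) ->
  ahlfors_regular (boundary_metric R T) Q.
Proof.
move=> a00 a01 bd Sa.
have M0 : 0 < 2 `^ Q :> R by rewrite powR_gt0.
have M1 : 1 <= 2 `^ Q :> R by rewrite -[leLHS](powRr0 2) ler_powR ?ler1n// ltW.
have Hge x : ((a0 * weight (level x) / 2 `^ Q)%:E <= H (cylinder x))%E.
  by apply: hausdorff_cylinder_ge => S /Sa/andP[].
have Hle x : (H (cylinder x) <= (a1 * weight (level x))%:E)%E.
  by apply: hausdorff_cylinder_le => S /Sa/andP[].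
split.
  (* With at most one point, the boundary would be covered by one set of diameter 0 and have measure
     0, against [Hge]. *)
  apply: contrapT => H1.
  have all_eq (z w : boundary_metric R T) : z = w.
    by apply: contrapT => zw; apply: H1; exists z, w.
  have : (H (cylinder troot) <= 0)%E.
    apply: hausdorff_measure_le => eta eta0.
    have dT : diam [set: boundary_metric R T] = 0%E.
      apply/le_anti; rewrite diam_ge0 andbT; apply: diam_le => // z w _ _.
      by rewrite (all_eq z w) mdistxx.
    have <- : (\esum_(i in [set tt])
        poweR (diam [set: boundary_metric R T]) Q = 0)%E.
      by rewrite dT poweR0r ?gt_eqF// esum1.
    apply: hausdorff_premeasure_le_esum; rewrite ?gt_eqF ?(ltW eta0)//.
    - by move=> z _; exists tt.
    - by move=> _ _; rewrite dT lee_fin ltW.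
  apply/negP; rewrite -ltNge; apply: lt_le_trans (Hge _).
  by rewrite lte_fin divr_gt0// mulr_gt0// weight_gt0.
(* One division by [2 ^ Q] comes from [Hge]; the other, and the factor in the upper constant, from
   comparing the weights of levels [n] and [n.+1]. *)
exists (a0 / 2 `^ Q / 2 `^ Q), (a1 * 2 `^ Q); split.
- by rewrite !divr_gt0.
- apply: (@le_lt_trans _ _ a0).
    rewrite -mulrA ler_piMr ?(ltW a00)// -invfM.
    by rewrite invf_le1 ?mulr_gt0// mulr_ege1.
  by apply: (lt_le_trans a01); rewrite ler_peMr// ltW// (lt_trans a00).
move=> z r r0 rd; have r1 : 0 < r <= 1.
  by rewrite r0 -lee_fin (le_trans rd)// diam_boundary_le1.
have [n /andP[nr rn]] := exists_dyadic r1.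
have rQ : r `^ Q <= weight n.
  rewrite weightE; apply: ge0_ler_powR;
    by rewrite ?nnegrE ?invr_ge0 ?exprn_ge0 ?(ltW r0) ?(ltW Q_gt0) ?(ltW nr).
have rQ' : weight n.+1 <= r `^ Q.
  rewrite weightE; apply: ge0_ler_powR;
    by rewrite ?nnegrE ?invr_ge0 ?exprn_ge0 ?(ltW r0) ?(ltW Q_gt0) ?(ltW nr).
apply/andP; split.
- apply: (@le_trans _ _ (H (cylinder (sval z n.+1)))).
    apply: le_trans (Hge _); rewrite level_ray lee_fin.
    rewrite -!mulrA ler_pM2l// [leRHS]mulrC ler_pM2l ?invr_gt0//.
    by rewrite ler_pdivrMl// -weightS.
  apply: le_hausdorff_measure => w.
  by rewrite cylinder_ray => /le_trans; apply; exact: ltW.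
- apply: (@le_trans _ _ (H (cylinder (sval z n)))).
    apply: le_hausdorff_measure => w.
    by rewrite cylinder_ray => /le_trans; apply.
  apply: le_trans (Hle _) _; rewrite level_ray lee_fin weightS mulrA.
  by rewrite ler_wpM2l// mulr_ge0// ltW// (lt_trans a00).
Qed.

(* The cylinder below y is the ball of radius min(2^-|y|, diam Z); it is Z
   itself when y lies above the first branching vertex. *)
Lemma ahlfors_cylinder : (forall x : T, boundary_below x !=set0) ->
  ahlfors_regular (boundary_metric R T) Q ->
  exists c C : R, [/\ 0 < c, c < C & forall y : T,
    ((c * weight (level y))%:E <= H (cylinder y)
      <= (C * weight (level y))%:E)%E].
Proof.
move=> bd [[z0 [w0 zw0]] [c [C [c0 cC HB]]]].
have dE := diam_fin_num (diam_boundary_le1 R T).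
move: (diam_boundary_le1 R T); rewrite dE lee_fin; set d := fine _ => d1.
have d0 : 0 < d.
  rewrite -lte_fin -dE; apply: (@lt_le_trans _ _ (mdist z0 w0)%:E).
    by rewrite lte_fin mdist_gt0; apply/eqP.
  exact: mdist_le_diam.
have dQ1 : d `^ Q <= 1.
  by rewrite -(powRr0 d) ger_powR ?d0// ltW.
(* Regularity concerns radii up to [d], so the ball is taken of radius [min(2 ^- level y, d)]. Both
   numbers are at most 1, so their minimum is at least their product, whence [d ^ Q]. *)
exists (c * d `^ Q), C; split.
- by rewrite mulr_gt0// powR_gt0.
- by apply: le_lt_trans cC; rewrite ler_piMr// ltW.
move=> y; have [z yz] := bd y; pose r := Num.min (2 ^- level y) d.
have e0 : 0 < 2 ^- level y :> R by rewrite invr_gt0 exprn_gt0.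
have e1 : 2 ^- level y <= 1 :> R.
  by rewrite invf_le1 ?exprn_gt0// exprn_ege1// ler1n.
have r0 : 0 < r by rewrite lt_min e0.
have -> : cylinder y = cball (z : boundary_metric R T) r.
  apply/seteqP; split=> w; rewrite /cball /= le_min.
    move=> /(cylinder_mdist _ yz) ->; rewrite -lee_fin -dE.
    exact: mdist_le_diam.
  by move=> /andP[zw _]; apply/(cylinder_mdist _ yz).
have /andP[cH HC] : ((c * r `^ Q)%:E <= H (cball (z : boundary_metric R T) r)
    <= (C * r `^ Q)%:E)%E.
  by apply: HB => //; rewrite dE lee_fin ge_min lexx orbT.
have rQ : r `^ Q <= weight (level y).
  rewrite weightE; apply: ge0_ler_powR.
  - exact: ltW.
  - by rewrite nnegrE ltW.
  - by rewrite nnegrE ltW.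
  - by rewrite ge_min lexx.
have rQ' : d `^ Q * weight (level y) <= r `^ Q.
  rewrite weightE -powRM ?(ltW d0) ?(ltW e0)//; apply: ge0_ler_powR.
  - exact: ltW.
  - by rewrite nnegrE mulr_ge0 ?(ltW d0) ?(ltW e0).
  - by rewrite nnegrE ltW.
  - by rewrite le_min ler_piMl ?(ltW e0)//= ler_piMr ?(ltW d0).
apply/andP; split.
  by apply: le_trans cH; rewrite lee_fin -mulrA ler_pM2l.
by apply: le_trans HC _; rewrite lee_fin ler_pM2l// (lt_trans c0).
Qed.

(** It suffices to bound finite partial sums. At a small common scale each premeasure keeps half of
    the lower bound [c], and superadditivity over separated cylinders compares their sum with
    [M]. *)
Lemma esum_weight_le (c M : R) x S : 0 < c -> 0 < M ->
  (forall y : T, (c * weight (level y))%:E <= H (cylinder y))%E ->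
  (H (cylinder x) <= M%:E)%E -> Stop x S ->
  (\esum_(y in S) (weight (level y))%:E <= (2 * M / c)%:E)%E.
Proof.
move=> c0 M0 cH HM [_ tS Sx]; apply: ge_ereal_sup => _ [X [finX XS] <-].
rewrite fsbig_finite//; set F := fset_set X.
have FX y : y \in F -> S y by rewrite in_fset_set// => /set_mem/XS.
(* The first clause yields separation: a point outside the cylinder of [y] is at distance more than
   [2 ^- level y] from each of its points. *)
pose P y e := e <= 2 ^- level y /\
  ((c / 2 * weight (level y))%:E <=
    hausdorff_premeasure Q e (cylinder y))%E.
have [e e0 eP] : exists2 e, 0 < e & forall y, y \in (F : seq T) -> P y e.
  apply: exists_common_bound => y _.
  have [e e0 eH] : exists2 e, 0 < e & ((c / 2 * weight (level y))%:E <
      hausdorff_premeasure Q e (cylinder y))%E.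
    apply: hausdorff_measure_gt; apply: lt_le_trans (cH y).
    rewrite lte_fin ltr_pM2r ?weight_gt0// ltr_pdivrMr// ltr_pMr//.
    by rewrite ltr1n.
  exists (Num.min e (2 ^- level y)).
    by rewrite lt_min e0 invr_gt0 exprn_gt0.
  move=> t /andP[t0]; rewrite le_min => /andP[te ty]; split=> //.
  by rewrite (le_trans (ltW eH))// hausdorff_premeasure_nonincreasing.
have : (\sum_(y <- F) (c / 2 * weight (level y))%:E <= M%:E)%E.
  apply: le_trans HM; apply: le_trans (hausdorff_premeasure_le _ _ e0).
  apply: (@le_trans _ _
      (\sum_(y <- F) hausdorff_premeasure Q e (cylinder y))%E).
    by rewrite big_seq [leRHS]big_seq; apply: lee_sum => y /eP[].
  apply: sum_hausdorff_premeasure_le => //.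
  - move=> y /FX Sy z yz; have : (\bigcup_(y in S) boundary_below y) z.
      by exists y.
    by rewrite Sx.
  - move=> y y' /[dup] yF /FX Sy /FX Sy' yy' z w yz y'w.
    rewrite ltNge; apply/negP => zw; case/eqP: yy'.
    apply: (disjoint_cylinder (R := R) (z := w) tS) => //.
    by apply/(cylinder_mdist _ yz); apply: le_trans zw _; have [] := eP y yF.
rewrite !sumEFin !lee_fin -mulr_sumr -ler_pdivlMl ?divr_gt0//.
by rewrite invf_div mulrAC.
Qed.

(** Covers of the cylinders of [S] together cover the cylinder of [x]. Weights being positive, the
    factor 2 leaves strict room above each premeasure, so that a cover can be picked from the
    infimum. *)
Lemma le_esum_weight (C m : R) x S : 0 < C ->
  (forall y : T, H (cylinder y) <= (C * weight (level y))%:E)%E ->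
  (m%:E <= H (cylinder x))%E -> Stop x S ->
  ((m / (2 * C))%:E <= \esum_(y in S) (weight (level y))%:E)%E.
Proof.
move=> C0 HC mH [_ _ Sx].
have w0 (y : T) : (0 <= (weight (level y))%:E)%E.
  by rewrite lee_fin ltW// weight_gt0.
have C20 : 0 < 2 * C by rewrite mulr_gt0.
(* The negated conclusion makes the stopping sum finite, hence [S] countable. *)
rewrite leNgt; apply/negP => Soo.
have Scnt : countable S.
  apply: (@esum_lty_countable R _ _ (fun y => (weight (level y))%:E)).
    by move=> y _; rewrite lte_fin weight_gt0.
  by rewrite (lt_trans Soo) ?ltry.
suff : (H (cylinder x) <= (2 * C)%:E * \esum_(y in S) (weight (level y))%:E)%E.
  move/(le_trans mH); rewrite leNgt => /negP; apply.
  by rewrite -lte_pdivlMl// -EFinM mulrC.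
apply: hausdorff_measure_le => e e0.
have /choice[U UP] y : exists U : (set (boundary_metric R T))^nat,
    [/\ cylinder y `<=` \bigcup_n U n, forall n, (diam (U n) <= e%:E)%E
      & (\esum_(n in setT) poweR (diam (U n)) Q
          <= (2 * C)%:E * (weight (level y))%:E)%E].
  have : (hausdorff_premeasure Q e (cylinder y) <
      (2 * C)%:E * (weight (level y))%:E)%E.
    apply: le_lt_trans (hausdorff_premeasure_le _ _ e0) _.
    apply: le_lt_trans (HC y) _; rewrite -EFinM lte_fin ltr_pM2r ?weight_gt0//.
    by rewrite ltr_pMl// ltr1n.
  move=> /ereal_inf_lt[_ [U [yU Ue] <-] lt]; exists U; split=> //.
  by rewrite -nneseries_esumT ?ltW// => n; exact: poweR_ge0.
apply: (@le_trans _ _ (\esum_(k in S `*`` (fun=> [set: nat]))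
    poweR (diam (U k.1 k.2)) Q)%E).
  apply: hausdorff_premeasure_le_esum; rewrite ?gt_eqF ?(ltW e0)//.
  - by apply: countableXR => // y _; exact: countableP.
  - move=> z xz; have [y Sy yz] : (\bigcup_(y in S) boundary_below y) z.
      by rewrite Sx.
    have [yU _ _] := UP y; have [n _ Uz] := yU z yz.
    by exists (y, n).
  - by move=> [y n] _ /=; have [_ + _] := UP y; apply.
rewrite -(esum_esum (a := fun y n => poweR (diam (U y n)) Q)); last first.
  by move=> *; exact: poweR_ge0.
apply: (@le_trans _ _ (\esum_(y in S) ((2 * C)%:E * (weight (level y))%:E))%E).
  by apply: le_esum => y _; have [] := UP y.
by apply: esumZl_le => //; exact: ltW.
Qed.

End Regularity.

Theorem lemma1p1 (R : realType) (Q : R) (T : rooted_tree)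
    (Q_gt0 : 0 < Q)
    (has_edge : exists x y : T, adj x y)
    (two_edges : forall x : T, x <> troot ->
      exists y z : T, [/\ y <> z, adj x y & adj x z]) :
  ahlfors_regular (boundary_metric R T) Q <->
  exists a0 a1 : R, [/\ 0 < a0, a0 < a1 &
    forall (x : T) (S : set T), Stop x S ->
      ((a0 * 2 `^ (- (Q * (level x)%:R)))%:E
         <= \esum_(y in S) (2 `^ (- (Q * (level y)%:R)))%:E
         <= (a1 * 2 `^ (- (Q * (level x)%:R)))%:E)%E].
Proof.
have bd := exists_ray has_edge two_edges.
split=> [/(ahlfors_cylinder Q_gt0 bd)|[a0 [a1 [a00 a01]]]]; last first.
  exact: ahlfors_of_stop.
move=> [c [C [c0 cC HT]]]; have C0 := lt_trans c0 cC.
(* These come from [le_esum_weight] and [esum_weight_le]. They are reciprocal, and [c < 2 * C] puts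
   them on either side of 1. *)
exists (c / (2 * C)), (2 * C / c); split.
- by rewrite divr_gt0// mulr_gt0.
- have c2C : c < 2 * C by rewrite (lt_trans cC)// ltr_pMl// ltr1n.
  apply: (@lt_trans _ _ 1); first by rewrite ltr_pdivrMr ?mul1r// mulr_gt0.
  by rewrite ltr_pdivlMr// mul1r.
move=> x S xS; have /andP[cH HC] := HT x; apply/andP; split.
- rewrite mulrAC; apply: (le_esum_weight Q_gt0 C0) xS => // y.
  by have /andP[] := HT y.
- rewrite mulrAC -[2 * C * _]mulrA; apply: (esum_weight_le Q_gt0 c0) xS => //.
  + by rewrite mulr_gt0 ?powR_gt0.
  + by move=> y; have /andP[] := HT y.
Qed.
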